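(* Let $(A,\nwarrow,\nearrow,\swarrow,\searrow,\alpha,\beta,\tilde\alpha,\tilde\beta)$ be a quadri-bialgebra induced from a skew-symmetric solution $r\in A\otimes A$ of the $Q$-equations. Then for all $\lambda_1,\lambda_2,\lambda_3\in\mathbb F$ the linear operator $$N_{\lambda_1,\lambda_2,\lambda_3}((x,a^* )):=(\lambda_1T_r(a^* )+\lambda_2x,\ \lambda_3a^* ),\qquad x\in A,\ a^*\in A^*,$$ is a Nijenhuis operator on the Drinfeld $Q$-double $\mathcal{QD}(A)$ (with respect to its four quadri-algebra operations).
   Context: All vector spaces are finite-dimensional over a fixed field $\mathbb F$. A quadri-algebra $(A,\nwarrow,\nearrow,\swarrow,\searrow)$ is a vector space with four bilinear operations; put $x\succ y=x\nearrow y+x\searrow y$, $x\prec y=x\nwarrow y+x\swarrow y$, $x\vee y=x\swarrow y+x\searrow y$, $x\wedge y=x\nwarrow y+x\nearrow y$, $x\star y=x\nwarrow y+x\nearrow y+x\swarrow y+x\searrow y$ (likewise with subscript $*$); the axioms are, for all $x,y,z$: $(x\nwarrow y)\nwarrow z=x\nwarrow(y\star z)$, $(x\nearrow y)\nwarrow z=x\nearrow(y\prec z)$, $(x\wedge y)\nearrow z=x\nearrow(y\succ z)$, $(x\swarrow y)\nwarrow z=x\swarrow(y\wedge z)$, $(x\searrow y)\nwarrow z=x\searrow(y\nwarrow z)$, $(x\vee y)\nearrow z=x\searrow(y\nearrow z)$, $(x\prec y)\swarrow z=x\swarrow(y\vee z)$, $(x\succ y)\swarrow z=x\searrow(y\swarrow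 z)$, $(x\star y)\searrow z=x\searrow(y\searrow z)$. $L_\circ(x)y=x\circ y=R_\circ(y)x$. For $\rho:A\to\mathfrak{gl}(V)$ linear, $\rho^*:A\to\mathfrak{gl}(V^* )$ is $\langle\rho^*(x)v^*,u\rangle=\langle v^*,\rho(x)u\rangle$ (no sign); $A^{**}=A$. For $r=\sum_ia_i\otimes b_i\in A\otimes A$: $T_r:A^*\to A$ is defined by $\langle u^*,T_r(v^* )\rangle=\langle u^*\otimes v^*,r\rangle$; $r$ is skew-symmetric if it is minus its flip. With $r_{12}\diamond r_{13}=\sum_{i,j}a_i\diamond a_j\otimes b_i\otimes b_j$, $r_{13}\diamond r_{23}=\sum_{i,j}a_i\otimes a_j\otimes b_i\diamond b_j$, $r_{23}\diamond r_{12}=\sum_{i,j}a_j\otimes a_i\diamond b_j\otimes b_i$, the $Q$-equations are $r_{23}\wedge r_{12}-r_{13}\succ r_{23}+r_{12}\swarrow r_{13}=0$ and $r_{23}\vee r_{12}-r_{12}\prec r_{13}+r_{13}\nearrow r_{23}=0$. A skew-symmetric solution $r$ induces a quadri-bialgebra structure (in particular the dual maps of the comultiplications form a quadri-algebra on $A^*$) with $\alpha(x)=(-1\otimes L_\searrow(x)+R_\star(x)\otimes1)r$, $\beta(x)=(1\otimes L_\vee(x)-R_\prec(x)\otimes1)r$, $\tilde\alpha(x)=(1\otimes L_\succ(x)-R_\wedge(x)\otimes1)r$, $\tilde\beta(x)=(-1\otimes L_\star(x)+R_\nwarrow(x)\otimes1)r$. The quadri-algebra structure on $A^*$ is $\nwarrow_*=\alpha^*$,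 $\nearrow_*=\beta^*$, $\swarrow_*=\tilde\alpha^*$, $\searrow_*=\tilde\beta^*$, where $\langle a^*\nwarrow_*b^*,x\rangle=\langle a^*\otimes b^*,\alpha(x)\rangle$, etc. The quadri-algebra structure of the Drinfeld $Q$-double $\mathcal{QD}(A)=A\oplus A^*$ extends those of $A$ and $A^*$ and is given on mixed products by $x\nwarrow_\bullet a^*=R_\searrow^*(x)a^*+L_{\star_*}^*(a^* )x$, $a^*\nwarrow_\bullet x=R_{\searrow_*}^*(a^* )x+L_\star^*(x)a^*$, $x\nearrow_\bullet a^*=-R_\vee^*(x)a^*-L_{\prec_*}^*(a^* )x$, $a^*\nearrow_\bullet x=-R_{\vee_*}^*(a^* )x-L_\prec^*(x)a^*$, $x\swarrow_\bullet a^*=-R_\succ^*(x)a^*-L_{\wedge_*}^*(a^* )x$, $a^*\swarrow_\bullet x=-R_{\succ_*}^*(a^* )x-L_\wedge^*(x)a^*$, $x\searrow_\bullet a^*=R_\star^*(x)a^*+L_{\nwarrow_*}^*(a^* )x$, $a^*\searrow_\bullet x=R_{\star_*}^*(a^* )x+L_\nwarrow^*(x)a^*$. A linear operator $N$ on a vector space with a set $\Omega$ of bilinear operations is a Nijenhuis operator if for each $\ast\in\Omega$ and all $u,v$: $N(u)\ast N(v)=N(N(u)\ast v+u\ast N(v)-N(u\ast v))$. *)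

(* Defs.v *)
From HB Require Import structures.
From mathcomp Require Import all_boot all_algebra.

Set Implicit Arguments.
Unset Strict Implicit.
Unset Printing Implicit Defensive.

Import GRing.Theory.
Local Open Scope ring_scope.

Notation bilin f := (bilinear_for *:%R *:%R f).

Section Tensor.
Variable F : fieldType.

Definition bas (U : vectType F) (i : 'I_(\dim {:U})) : U := (vbasis {:U})`_i.

(* An element of U ⊗ V is its matrix of coordinates in the chosen bases. *)
Definition tensor (U V : vectType F) : vectType F :=
  'M[F]_(\dim {:U}, \dim {:V}).

Definition tens (U V : vectType F) (u : U) (v : V) : tensor U V :=
  \matrix_(i, j) (coord (vbasis {:U}) i u * coord (vbasis {:V}) j v).

(* The linear map U ⊗ V -> W induced by a bilinear map f, i.e.
   sum_i a_i ⊗ b_i |-> sum_i f a_i b_i (see [tlift_sum]). *)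
Definition tlift (U V W : vectType F) (f : U -> V -> W) (t : tensor U V) : W :=
  \sum_i \sum_j t i j *: f (bas i) (bas j).

Lemma tens_bilin (U V : vectType F) : bilin (@tens U V).
Proof.
split=> [v|u] c x y; apply/matrixP=> i j; rewrite !mxE linearP /=.
  by rewrite mulrDl -mulrA.
by rewrite mulrDr mulrCA.
Qed.

Lemma vect_coord (U : vectType F) (u : U) :
  u = \sum_i coord (vbasis {:U}) i u *: bas i.
Proof. exact: coord_vbasis (memvf u). Qed.

Lemma coord_bas (U : vectType F) (i j : 'I_(\dim {:U})) :
  coord (vbasis {:U}) i (bas j) = (i == j)%:R.
Proof. by rewrite eq_sym; apply: coord_free (basis_free (vbasisP _)). Qed.

Lemma tlift_linear (U V W : vectType F) (f : U -> V -> W) : linear (tlift f).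
Proof.
move=> c s t; rewrite /tlift scaler_sumr -big_split /=.
apply: eq_bigr => i _; rewrite scaler_sumr -big_split /=.
by apply: eq_bigr => j _; rewrite !mxE scalerDl scalerA.
Qed.

Lemma bilin_sum (U V W : vectType F) (f : U -> V -> W) (Hf : bilin f)
    (I J : finType) (c : I -> F) (d : J -> F) (x : I -> U) (y : J -> V) :
  f (\sum_i c i *: x i) (\sum_j d j *: y j) =
  \sum_i \sum_j (c i * d j) *: f (x i) (y j).
Proof.
have fl v : linear (f ^~ v) := Hf.1 v.
have fr u : linear (f u) := Hf.2 u.
have f0l v : f 0 v = 0.
  by have := fl v (-1) 0 0; rewrite scaler0 add0r scaleN1r addNr.
have f0r u : f u 0 = 0.
  by have := fr u (-1) 0 0; rewrite scaler0 add0r scaleN1r addNr.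
rewrite (big_morph (f ^~ _) (id1 := 0) (op1 := +%R)) //; last first.
  by move=> u v; have := fl (\sum_j d j *: y j) 1 u v; rewrite !scale1r.
apply: eq_bigr => i _.
rewrite (big_morph (f _) (id1 := 0) (op1 := +%R)) //; last first.
  by move=> u v; have := fr (c i *: x i) 1 u v; rewrite !scale1r.
apply: eq_bigr => j _.
have := fl (d j *: y j) (c i) (x i) 0; rewrite addr0 f0l addr0 => ->.
by have := fr (x i) (d j) (y j) 0; rewrite addr0 f0r addr0 => ->; rewrite scalerA.
Qed.

Lemma tlift_tens (U V W : vectType F) (f : U -> V -> W) (Hf : bilin f) u v :
  tlift f (tens u v) = f u v.
Proof.
rewrite {2}[u]vect_coord {2}[v]vect_coord bilin_sum //.
apply: eq_bigr => i _; apply: eq_bigr => j _.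
by rewrite mxE.
Qed.

Lemma tlift_sum (U V W : vectType F) (f : U -> V -> W) (Hf : bilin f)
    (n : nat) (a : 'I_n -> U) (b : 'I_n -> V) :
  tlift f (\sum_i tens (a i) (b i)) = \sum_i f (a i) (b i).
Proof.
have H : tlift f 0 = 0.
  by rewrite /tlift big1 // => i _; rewrite big1 // => j _; rewrite mxE scale0r.
rewrite (big_morph (tlift f) (id1 := 0) (op1 := +%R)) //.
  by apply: eq_bigr => i _; rewrite tlift_tens.
by move=> s t; have := tlift_linear f 1 s t; rewrite !scale1r.
Qed.

Lemma tens_span (U V : vectType F) (t : tensor U V) :
  t = \sum_i \sum_j t i j *: tens (bas i) (bas j).
Proof.
rewrite {1}[t]matrix_sum_delta; apply: eq_bigr => i _; apply: eq_bigr => j _.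
congr (_ *: _); apply/matrixP=> k l; rewrite !mxE !coord_bas -natrM mulnb.
by [].
Qed.

End Tensor.

Section Dual.
Variables (F : fieldType).

Definition dual (V : vectType F) : vectType F := 'Hom(V, F^o).

(* A** = A : the evaluation map and its inverse. *)
Definition ev (V : vectType F) (v : V) : dual (dual V) :=
  linfun (fun f : dual V => f v).

Definition unev (V : vectType F) : dual (dual V) -> V :=
  (linfun (@ev V))^-1%VF.

(* <rho^*(x) v, u> = <v, rho(x) u>, without sign *)
Definition adj (V : vectType F) (f : 'End(V)) (g : dual V) : dual V :=
  (g \o f)%VF.

(* The same for an endomorphism of V*, its transpose acting on V** = V. *)
Definition coadj (V : vectType F) (f : 'End(dual V)) (v : V) : V :=
  unev (adj f (ev v)).

Lemma linfun_of (U V : vectType F) (f : U -> V) :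
  linear f -> linfun f =1 f.
Proof.
move=> fl.
pose fz : {linear U -> V} :=
  HB.pack f (GRing.isLinear.Build F U V *:%R f fl).
exact: (lfunE fz).
Qed.

Lemma evE (V : vectType F) (v : V) (f : dual V) : ev v f = f v.
Proof.
rewrite /ev linfun_of // => c g h.
by rewrite add_lfunE scale_lfunE.
Qed.

Lemma ev_linear (V : vectType F) : linear (@ev V).
Proof.
by move=> c u v; apply/lfunP=> f; rewrite add_lfunE scale_lfunE !evE linearP.
Qed.

Lemma adjE (V : vectType F) (f : 'End(V)) g v : adj f g v = g (f v).
Proof. by rewrite /adj comp_lfunE. Qed.

Lemma ev_inj (V : vectType F) : injective (@ev V).
Proof.
move=> u v uv; rewrite [u]vect_coord [v]vect_coord.
apply: eq_bigr => i _; congr (_ *: _).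
have E x : ev x (linfun (coord (vbasis {:V}) i : V -> F^o))
         = coord (vbasis {:V}) i x by rewrite evE lfunE.
by rewrite -!E uv.
Qed.

Lemma dim_dual (V : vectType F) : dim (dual V) = dim V.
Proof. by rewrite /dim /= muln1. Qed.

Lemma unevK (V : vectType F) : cancel (@unev V) (@ev V).
Proof.
move=> phi; rewrite -(linfun_of (@ev_linear V)) /unev.
apply: limg_lfunVK.
have -> : limg (linfun (@ev V)) = fullv.
  apply/eqP; rewrite eqEdim subvf /= limg_dim_eq.
    by rewrite !dimvf !dim_dual.
  apply/eqP; rewrite -subv0; apply/subvP=> v; rewrite memv_cap => /andP[_].
  rewrite memv_ker linfun_of ?memv0; last exact: ev_linear.
  move=> /eqP ev0; apply/eqP/ev_inj; rewrite ev0.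
  by apply/lfunP=> f; rewrite evE linear0 lfunE.
exact: memvf.
Qed.

Lemma unevE (V : vectType F) (phi : dual (dual V)) (f : dual V) :
  f (unev phi) = phi f.
Proof. by rewrite -evE unevK. Qed.

Lemma coadjE (V : vectType F) (f : 'End(dual V)) (v : V) (g : dual V) :
  g (coadj f v) = f g v.
Proof. by rewrite unevE adjE evE. Qed.

End Dual.

Inductive arrow := NW | NE | SW | SE.

(* Four binary operations on V, indexed by the arrows. *)
Definition quadri_ops (F : fieldType) (V : vectType F) := arrow -> V -> V -> V.

Section QuadriAlgebra.
Variables (F : fieldType) (A : vectType F) (Q : quadri_ops A).

Definition qsucc (x y : A) : A := Q NE x y + Q SE x y.
Definition qprec (x y : A) : A := Q NW x y + Q SW x y.
Definition qvee (x y : A) : A := Q SW x y + Q SE x y.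
Definition qwedge (x y : A) : A := Q NW x y + Q NE x y.
Definition qstar (x y : A) : A := Q NW x y + Q NE x y + Q SW x y + Q SE x y.

Record quadri_algebra : Prop := QuadriAlgebra {
  quadri_bilin : forall d, bilin (Q d);
  quadri_nwnw : forall x y z, Q NW (Q NW x y) z = Q NW x (qstar y z);
  quadri_nenw : forall x y z, Q NW (Q NE x y) z = Q NE x (qprec y z);
  quadri_wene : forall x y z, Q NE (qwedge x y) z = Q NE x (qsucc y z);
  quadri_swnw : forall x y z, Q NW (Q SW x y) z = Q SW x (qwedge y z);
  quadri_senw : forall x y z, Q NW (Q SE x y) z = Q SE x (Q NW y z);
  quadri_vene : forall x y z, Q NE (qvee x y) z = Q SE x (Q NE y z);
  quadri_prsw : forall x y z, Q SW (qprec x y) z = Q SW x (qvee y z);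
  quadri_susw : forall x y z, Q SW (qsucc x y) z = Q SE x (Q SW y z);
  quadri_stse : forall x y z, Q SE (qstar x y) z = Q SE x (Q SE y z)
}.

End QuadriAlgebra.

Section Multiplications.
Variables (F : fieldType) (A : vectType F).

Definition Lmul (op : A -> A -> A) (x : A) : 'End(A) := linfun (op x).
Definition Rmul (op : A -> A -> A) (x : A) : 'End(A) := linfun (op^~ x).

End Multiplications.

Section QEquations.
Variables (F : fieldType) (A : vectType F).
Implicit Types (op : A -> A -> A) (r : tensor A A).

Definition flip r : tensor A A := tlift (fun a b => tens b a) r.

Definition skew_symmetric r : Prop := r = - flip r.

Definition T_ r (v : dual A) : A := tlift (fun a b : A => v b *: a) r.

(* <u ⊗ v, t> *)
Definition pairing (u v : dual A) (t : tensor A A) : F :=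
  tlift (fun a b : A => (u a * v b : F^o)) t.

(* A ⊗ A ⊗ A is taken to be A ⊗ (A ⊗ A). *)
Definition tens3 (a b c : A) : tensor A (tensor A A) := tens a (tens b c).

(* sum over i, j of f a_i b_i a_j b_j, where r = sum_i a_i ⊗ b_i *)
Definition tlift2 (W : vectType F) (f : A -> A -> A -> A -> W) r : W :=
  tlift (fun ai bi => tlift (f ai bi) r) r.

Definition r12_r13 op r :=
  tlift2 (fun ai bi aj bj => tens3 (op ai aj) bi bj) r.

Definition r13_r23 op r :=
  tlift2 (fun ai bi aj bj => tens3 ai aj (op bi bj)) r.

Definition r23_r12 op r :=
  tlift2 (fun ai bi aj bj => tens3 aj (op ai bj) bi) r.

Definition Q_equations (Q : quadri_ops A) r : Prop :=
  r23_r12 (qwedge Q) r - r13_r23 (qsucc Q) r + r12_r13 (Q SW) r = 0 /\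
  r23_r12 (qvee Q) r - r12_r13 (qprec Q) r + r13_r23 (Q NE) r = 0.

(* (f ⊗ 1) r and (1 ⊗ f) r *)
Definition act1 (f : 'End(A)) r : tensor A A := tlift (fun a b => tens (f a) b) r.
Definition act2 (f : 'End(A)) r : tensor A A := tlift (fun a b => tens a (f b)) r.

(* alpha, beta, alpha~, beta~, indexed by the product on A* which they induce *)
Definition comul (Q : quadri_ops A) r (d : arrow) (x : A) : tensor A A :=
  match d with
  | NW => - act2 (Lmul (Q SE) x) r + act1 (Rmul (qstar Q) x) r
  | NE => act2 (Lmul (qvee Q) x) r - act1 (Rmul (qprec Q) x) r
  | SW => act2 (Lmul (qsucc Q) x) r - act1 (Rmul (qwedge Q) x) r
  | SE => - act2 (Lmul (qstar Q) x) r + act1 (Rmul (Q NW) x) r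
  end.

Definition dual_ops (delta : arrow -> A -> tensor A A) : quadri_ops (dual A) :=
  fun d a b => linfun (fun x : A => (pairing a b (delta d x) : F^o)).

End QEquations.

Section Double.
Variables (F : fieldType) (A : vectType F).
Variables (Q : quadri_ops A) (P : quadri_ops (dual A)).

(* x . a* and a* . x *)
Definition mixed (d : arrow) (x : A) (a : dual A) : A * dual A :=
  match d with
  | NW => (coadj (Lmul (qstar P) a) x, adj (Rmul (Q SE) x) a)
  | NE => (- coadj (Lmul (qprec P) a) x, - adj (Rmul (qvee Q) x) a)
  | SW => (- coadj (Lmul (qwedge P) a) x, - adj (Rmul (qsucc Q) x) a)
  | SE => (coadj (Lmul (P NW) a) x, adj (Rmul (qstar Q) x) a)
  end.

Definition mixed' (d : arrow) (a : dual A) (x : A) : A * dual A :=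
  match d with
  | NW => (coadj (Rmul (P SE) a) x, adj (Lmul (qstar Q) x) a)
  | NE => (- coadj (Rmul (qvee P) a) x, - adj (Lmul (qprec Q) x) a)
  | SW => (- coadj (Rmul (qsucc P) a) x, - adj (Lmul (qwedge Q) x) a)
  | SE => (coadj (Rmul (qstar P) a) x, adj (Lmul (Q NW) x) a)
  end.

Definition QD : quadri_ops (A * dual A)%type := fun d u v =>
  (Q d u.1 v.1, 0) + mixed d u.1 v.2 + mixed' d u.2 v.1 + (0, P d u.2 v.2).

End Double.

Definition nijenhuis (F : fieldType) (V : vectType F) (I : Type)
    (op : I -> V -> V -> V) (N : V -> V) : Prop :=
  linear N /\
  forall i u v, op i (N u) (N v) = N (op i (N u) v + op i u (N v) - N (op i u v)).

Definition N_op (F : fieldType) (A : vectType F) (r : tensor A A)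
    (l1 l2 l3 : F) (u : A * dual A) : A * dual A :=
  (l1 *: T_ r u.2 + l2 *: u.1, l3 *: u.2).

(* The definitions above read as in the mathematics: the functions passed to
   [linfun] are linear and the ones passed to [tlift] are bilinear. *)
Section Sanity.
Variables (F : fieldType) (A : vectType F).
Implicit Types (op : A -> A -> A) (r : tensor A A).

Lemma LmulE op x y : bilin op -> Lmul op x y = op x y.
Proof. by move=> H; rewrite linfun_of //; apply: H.2. Qed.

Lemma RmulE op x y : bilin op -> Rmul op x y = op y x.
Proof. by move=> H; rewrite linfun_of //; apply: H.1. Qed.

Lemma pairing_tens (u v : dual A) (a b : A) :
  pairing u v (tens a b) = u a * v b.
Proof.
rewrite /pairing tlift_tens //; split=> [y|x] c s t.
  by rewrite linearP /= mulrDl -scalerAl.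
by rewrite linearP /= mulrDr -scalerAr.
Qed.

Lemma T_E r (u v : dual A) : u (T_ r v) = pairing u v r.
Proof.
rewrite /T_ /pairing /tlift linear_sum; apply: eq_bigr => i _.
rewrite linear_sum; apply: eq_bigr => j _; rewrite !linearZ /=.
by rewrite scalerA; apply: (mulrC (_ * _)).
Qed.

Lemma bilinD (V : vectType F) (f g : V -> V -> V) :
  bilin f -> bilin g -> bilin (fun x y => f x y + g x y).
Proof.
move=> Hf Hg; split=> [y|x] c s t.
  by rewrite (Hf.1 y) (Hg.1 y) /= scalerDr addrACA.
by rewrite (Hf.2 x) (Hg.2 x) /= scalerDr addrACA.
Qed.

Lemma derived_bilin (V : vectType F) (Q : quadri_ops V) :
  (forall d, bilin (Q d)) ->
  [/\ bilin (qsucc Q), bilin (qprec Q), bilin (qvee Q), bilin (qwedge Q)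
    & bilin (qstar Q)].
Proof.
move=> H; have HD c d : bilin (fun x y => Q c x y + Q d x y) by apply: bilinD.
by split; [exact: HD..|do 2!apply: bilinD => //].
Qed.

Lemma tlift_ext (U V W : vectType F) (f g : U -> V -> W) t :
  f =2 g -> tlift f t = tlift g t.
Proof.
by move=> fg; apply: eq_bigr => i _; apply: eq_bigr => j _; rewrite fg.
Qed.

Lemma tlift_fun_linear (U V W : vectType F) (f g h : U -> V -> W) c t :
  (forall x y, f x y = c *: g x y + h x y) ->
  tlift f t = c *: tlift g t + tlift h t.
Proof.
move=> E; rewrite /tlift scaler_sumr -big_split /=; apply: eq_bigr => i _.
rewrite scaler_sumr -big_split /=; apply: eq_bigr => j _.
by rewrite E scalerDr !scalerA mulrC.
Qed.

Lemma act1_linear op r : bilin op -> linear (fun x => act1 (Rmul op x) r).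
Proof.
move=> H c x y; apply: tlift_fun_linear => a b.
by rewrite !RmulE // (H.2 a) ((tens_bilin _ _).1 b).
Qed.

Lemma act2_linear op r : bilin op -> linear (fun x => act2 (Lmul op x) r).
Proof.
move=> H c x y; apply: tlift_fun_linear => a b.
by rewrite !LmulE // (H.1 b) ((tens_bilin _ _).2 a).
Qed.

Lemma comul_linear (Q : quadri_ops A) r d :
  (forall d, bilin (Q d)) -> linear (comul Q r d).
Proof.
move=> H; have [Hs Hp Hv Hw Hst] := derived_bilin H.
by case: d => c x y; rewrite /comul act1_linear ?act2_linear //;
  rewrite ?scalerDr ?scalerN opprD addrACA.
Qed.

Lemma dual_opsE (delta : arrow -> A -> tensor A A) d (a b : dual A) x :
  linear (delta d) -> dual_ops delta d a b x = pairing a b (delta d x).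
Proof.
move=> H; rewrite linfun_of // => c y z.
by rewrite H /pairing tlift_linear.
Qed.

Lemma dual_ops_bilin (delta : arrow -> A -> tensor A A) d :
  (forall d, linear (delta d)) -> bilin (dual_ops delta d).
Proof.
move=> H; split=> [b|a] c u v; apply/lfunP=> x;
  rewrite add_lfunE scale_lfunE !dual_opsE //;
  apply: tlift_fun_linear => y z; rewrite add_lfunE scale_lfunE.
  by rewrite mulrDl -scalerAl.
by rewrite mulrDr -scalerAr.
Qed.

End Sanity.

Section SanityDouble.
Variables (F : fieldType) (A : vectType F).

Lemma dual_sep (x y : A) : (forall g : dual A, g x = g y) -> x = y.
Proof. by move=> H; apply: ev_inj; apply/lfunP=> g; rewrite !evE. Qed.

Lemma coadj_Lmul_bilin (op : dual A -> dual A -> dual A) :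
  bilin op -> bilin (fun x a => coadj (Lmul op a) x).
Proof.
move=> H; split=> [a|x] c s t; apply: dual_sep => g;
  rewrite /= linearP /= !coadjE !LmulE ?linearP //.
by rewrite (H.1 g) add_lfunE scale_lfunE.
Qed.

Lemma coadj_Rmul_bilin (op : dual A -> dual A -> dual A) :
  bilin op -> bilin (fun a x => coadj (Rmul op a) x).
Proof.
move=> H; split=> [x|a] c s t; apply: dual_sep => g;
  rewrite /= linearP /= !coadjE !RmulE ?linearP //.
by rewrite (H.2 g) add_lfunE scale_lfunE.
Qed.

Lemma adj_Rmul_bilin (op : A -> A -> A) :
  bilin op -> bilin (fun x (a : dual A) => adj (Rmul op x) a).
Proof.
move=> H; split=> [a|x] c s t; apply/lfunP=> y;
  rewrite add_lfunE scale_lfunE !adjE !RmulE //.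
  by rewrite (H.2 y) linearP.
by rewrite add_lfunE scale_lfunE.
Qed.

Lemma adj_Lmul_bilin (op : A -> A -> A) :
  bilin op -> bilin (fun (a : dual A) x => adj (Lmul op x) a).
Proof.
move=> H; split=> [x|a] c s t; apply/lfunP=> y;
  rewrite add_lfunE scale_lfunE !adjE !LmulE //.
  by rewrite add_lfunE scale_lfunE.
by rewrite (H.1 y) linearP.
Qed.

Lemma bilin_pair (U V W X : vectType F) (f : U -> V -> W) (g : U -> V -> X) :
  bilin f -> bilin g -> bilin (fun u v => (f u v, g u v) : W * X).
Proof.
by move=> Hf Hg; split=> [v|u] c s t;
  [rewrite (Hf.1 v) (Hg.1 v)|rewrite (Hf.2 u) (Hg.2 u)].
Qed.

Lemma bilinN (U V W : vectType F) (f : U -> V -> W) :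
  bilin f -> bilin (fun u v => - f u v).
Proof.
by move=> Hf; split=> [v|u] c s t;
  [rewrite (Hf.1 v)|rewrite (Hf.2 u)]; rewrite /= opprD scalerN.
Qed.

Variables (Q : quadri_ops A) (P : quadri_ops (dual A)).
Hypotheses (HQ : forall d, bilin (Q d)) (HP : forall d, bilin (P d)).

Lemma mixed_bilin d : bilin (mixed Q P d).
Proof.
have [? ? ? ? ?] := derived_bilin HQ; have [? ? ? ? ?] := derived_bilin HP.
by case: d; apply: bilin_pair; try apply: bilinN;
  (exact: coadj_Lmul_bilin || exact: adj_Rmul_bilin).
Qed.

Lemma mixed'_bilin d : bilin (mixed' Q P d).
Proof.
have [? ? ? ? ?] := derived_bilin HQ; have [? ? ? ? ?] := derived_bilin HP.
by case: d; apply: bilin_pair; try apply: bilinN;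
  (exact: coadj_Rmul_bilin || exact: adj_Lmul_bilin).
Qed.

Lemma bilin0 (U V W : vectType F) : bilin (fun (_ : U) (_ : V) => 0 : W).
Proof. by split=> [v|u] c s t; rewrite /= scaler0 addr0. Qed.

Lemma QD_bilin d : bilin (QD Q P d).
Proof.
do 3?[apply: bilinD].
- apply: (bilin_pair (f := fun u v => Q d u.1 v.1) (g := fun _ _ => 0)).
    by split=> [v|u] c s t; rewrite /= ?(HQ d).1 ?(HQ d).2.
  exact: bilin0.
- by split=> [v|u] c s t; [apply: (mixed_bilin d).1|apply: (mixed_bilin d).2].
- by split=> [v|u] c s t; [apply: (mixed'_bilin d).1|apply: (mixed'_bilin d).2].
apply: (bilin_pair (f := fun _ _ => 0) (g := fun u v => P d u.2 v.2)).
  exact: bilin0.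
by split=> [v|u] c s t; rewrite /= ?(HP d).1 ?(HP d).2.
Qed.

Lemma QD_A d (x y : A) : QD Q P d (x, 0) (y, 0) = (Q d x y, 0).
Proof.
have H1 := mixed_bilin d; have H2 := mixed'_bilin d; have H3 := HP d.
have E1 : mixed Q P d x 0 = 0.
  have /= := H1.2 x (-1) 0 0; rewrite scaler0 add0r => ->.
  by rewrite scaleN1r addNr.
have E2 : mixed' Q P d 0 y = 0.
  have /= := H2.1 y (-1) 0 0; rewrite scaler0 add0r => ->.
  by rewrite scaleN1r addNr.
have E3 : P d 0 0 = 0.
  have /= := H3.1 0 (-1) 0 0; rewrite scaler0 add0r => ->.
  by rewrite scaleN1r addNr.
by rewrite /QD /= E1 E2 E3 !addr0.
Qed.

End SanityDouble.

(* Main.v *)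
Require Import Defs.
From mathcomp Require Import all_boot all_algebra.
From mathcomp Require Import ring.

Import GRing.Theory.
Local Open Scope ring_scope.

(* Since [r] is skew-symmetric, each product of A^* is
   [a . b = l (T a) b + r (T b) a], where [l x b] and [r x a] are the
   A^*-components of the mixed products [x . b] and [a . x], and the
   A-components of these are [x . T b - T (l x b)] and [T a . x - T (r x a)].
   The Q-equations say that [T (a . b) = T a . T b].  Hence
   [(x, a) |-> (x + T a, a)] is an isomorphism from the double onto the
   semidirect product of A with A^*, where A^* multiplies trivially, and it
   carries [N_op r l1 l2 l3] to
   [(x, a) |-> (l2 x + (l1 - l2 + l3) T a, l3 a)]. *)

(** * Maps whose linearity or bilinearity is a bare property *)

Lemma linear_tlift {F : fieldType} {U V W X : vectType F} (g : W -> X)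
    (f : U -> V -> W) (t : tensor U V) :
  linear g -> g (tlift f t) = tlift (fun a b => g (f a b)) t.
Proof.
move=> gl; rewrite -(linfun_of gl) /tlift linear_sum.
apply: eq_bigr => i _; rewrite linear_sum; apply: eq_bigr => j _.
by rewrite linearZ /= linfun_of.
Qed.

Section LinearFunction.
Context {F : fieldType} {U V : vectType F} {f : U -> V}.
Hypothesis Hf : linear f.

Lemma linear_fun0 : f 0 = 0.
Proof. by rewrite -(linfun_of Hf) linear0. Qed.

Lemma linear_funD x y : f (x + y) = f x + f y.
Proof. by rewrite -!(linfun_of Hf) linearD. Qed.

Lemma linear_funN x : f (- x) = - f x.
Proof. by rewrite -!(linfun_of Hf) linearN. Qed.

Lemma linear_funZ c x : f (c *: x) = c *: f x.
Proof. by rewrite -!(linfun_of Hf) linearZ. Qed.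

End LinearFunction.

Section Bilinear.
Context {F : fieldType} {U V W : vectType F} {f : U -> V -> W}.
Hypothesis Hf : bilin f.

Lemma bilinDl x y z : f (x + y) z = f x z + f y z.
Proof. exact: (linear_funD (Hf.1 z)). Qed.

Lemma bilinDr x y z : f x (y + z) = f x y + f x z.
Proof. exact: (linear_funD (Hf.2 x)). Qed.

Lemma bilinZl c x z : f (c *: x) z = c *: f x z.
Proof. exact: (linear_funZ (Hf.1 z)). Qed.

Lemma bilinZr c x z : f x (c *: z) = c *: f x z.
Proof. exact: (linear_funZ (Hf.2 x)). Qed.

Lemma bilinNl x z : f (- x) z = - f x z.
Proof. exact: (linear_funN (Hf.1 z)). Qed.

Lemma bilinNr x z : f x (- z) = - f x z.
Proof. exact: (linear_funN (Hf.2 x)). Qed.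

Lemma bilin_tlift {U1 V1 U2 V2 : vectType F} (g : U1 -> V1 -> U)
    (h : U2 -> V2 -> V) (s : tensor U1 V1) (t : tensor U2 V2) :
  f (tlift g s) (tlift h t) =
  tlift (fun a b => tlift (fun c d => f (g a b) (h c d)) t) s.
Proof.
rewrite (linear_tlift (f ^~ _) g s (Hf.1 _)); apply: tlift_ext => a b.
by rewrite (linear_tlift (f _) h t (Hf.2 _)).
Qed.

End Bilinear.

(** * Nijenhuis operators on a semidirect product *)

Section SemidirectProduct.
Context {F : fieldType} {A M : vectType F} (op : A -> A -> A)
  (l : A -> M -> M) (r : A -> M -> M) (T : M -> A).
Hypotheses (Hop : bilin op) (Hl : bilin l) (Hr : bilin r) (HT : linear T).
Hypothesis T_morph :
  forall a b, T (l (T a) b + r (T b) a) = op (T a) (T b).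

Definition semidirect (u v : A * M) : A * M :=
  (op u.1 v.1, l u.1 v.2 + r v.1 u.2).

Definition shear (u : A * M) : A * M := (u.1 + T u.2, u.2).

Lemma shear_inj : injective shear.
Proof. by case=> [x a] [y b] [/[swap] -> /addIr ->]. Qed.

Lemma shear_linear : linear shear.
Proof. by move=> c u v; congr (_, _); rewrite /= HT scalerDr addrACA. Qed.

Definition triangular_op (m k n : F) (u : A * M) : A * M :=
  (k *: u.1 + m *: T u.2, n *: u.2).

(** The [M]-components agree by bilinearity. In the [A]-component the cross terms
    [T (l x b + r y a)] with coefficient [k * m] cancel, and the remaining term in [m * m] is
    exactly [T_morph]. *)
Lemma semidirect_nijenhuis (m k n : F) (u v : A * M) :
  let N := triangular_op m k n in
  semidirect (N u) (N v) =
  N (semidirect (N u) v + semidirect u (N v) - N (semidirect u v)).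
Proof.
case: u v => [x a] [y b] /=; rewrite /semidirect /triangular_op /=.
have Tab := T_morph a b; rewrite (linear_funD HT) in Tab.
(* Applying an arbitrary functional turns each vector identity into a scalar one, within reach of
   [ring]. *)
congr (_, _); apply: dual_sep => g.
  have {Tab} := congr1 g Tab; rewrite linearD /= => Tab.
  rewrite !(bilinDl Hop, bilinDr Hop, bilinZl Hop, bilinZr Hop, bilinDl Hl,
            bilinDr Hr, bilinZl Hl, bilinZr Hl, bilinZl Hr, bilinZr Hr,
            bilinDl Hr, linear_funD HT, linear_funZ HT, linear_funN HT,
            linearD, linearZ, linearN) /=.
  rewrite -Tab /GRing.scale /=; ring.
rewrite !(bilinDl Hl, bilinDl Hr, bilinZl Hl, bilinZr Hl, bilinZl Hr,
          bilinZr Hr, linearD, linearZ, linearN) /= /GRing.scale /=; ring.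
Qed.

End SemidirectProduct.

(** * Skew-symmetry: the products of the double expressed through [T] *)

Section InducedStructure.
Context {F : fieldType} {A : vectType F} {Q : quadri_ops A} {r : tensor A A}.
Hypotheses (HQ : forall d, bilin (Q d)) (hskew : skew_symmetric r).
Hypothesis hr : Q_equations Q r.

Notation T := (T_ r).
Notation P := (dual_ops (comul Q r)).

Lemma T_linear : linear T.
Proof.
move=> c u v; apply: tlift_fun_linear => a b.
by rewrite add_lfunE scale_lfunE scalerDl scalerA.
Qed.

Lemma pairing_tlift (u v : dual A) (f : A -> A -> tensor A A) t :
  pairing u v (tlift f t) = tlift (fun a b => (pairing u v (f a b) : F^o)) t.
Proof.
by apply: (linear_tlift (pairing u v : _ -> F^o)); apply: tlift_linear.
Qed.

Lemma pairing_flip (u v : dual A) t : pairing u v (flip t) = pairing v u t.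
Proof.
rewrite pairing_tlift; apply: (tlift_ext (W := F^o)) => a b.
by rewrite pairing_tens mulrC.
Qed.

Lemma pairingD (u v : dual A) s t :
  pairing u v (s + t) = pairing u v s + pairing u v t.
Proof. exact: (linear_funD (tlift_linear (_ : A -> A -> F^o))). Qed.

Lemma pairingN (u v : dual A) t : pairing u v (- t) = - pairing u v t.
Proof. exact: (linear_funN (tlift_linear (_ : A -> A -> F^o))). Qed.

Lemma T_skew (u v : dual A) : u (T v) = - v (T u).
Proof. by rewrite !T_E [in LHS]hskew pairingN pairing_flip. Qed.

(** [T] contracts the second leg of [r]; by skew-symmetry, contracting the first leg gives [- T]. *)
Lemma T_oppE (u : dual A) : - T u = tlift (fun a b => (u a : F) *: b) r.
Proof.
apply: dual_sep => g; rewrite linearN /= -T_skew T_E [LHS]/pairing.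
rewrite (linear_tlift g) => [|c x y]; last exact: linearP.
by apply: tlift_ext => a b; rewrite linearZ.
Qed.

Lemma pairing_act1 (op : A -> A -> A) x (u v : dual A) : bilin op ->
  pairing u v (act1 (Rmul op x) r) = u (op (T v) x).
Proof.
move=> H; rewrite -(RmulE _ _ H) -adjE T_E pairing_tlift.
by apply: (tlift_ext (W := F^o)) => a b; rewrite pairing_tens adjE.
Qed.

Lemma pairing_act2 (op : A -> A -> A) x (u v : dual A) : bilin op ->
  pairing u v (act2 (Lmul op x) r) = - v (op x (T u)).
Proof.
move=> H; rewrite -(LmulE _ _ H) -[v _]adjE -T_skew T_E pairing_tlift.
by apply: (tlift_ext (W := F^o)) => a b; rewrite pairing_tens adjE.
Qed.

Definition lact (d : arrow) (x : A) (b : dual A) : dual A :=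
  (mixed Q P d x b).2.

Definition ract (d : arrow) (x : A) (a : dual A) : dual A :=
  (mixed' Q P d a x).2.

(** The [act2] term of each comultiplication gives the [lact] summand, its sign reversed by
    [pairing_act2], and the [act1] term gives the [ract] summand. *)
Lemma dual_ops_T d a b : P d a b = lact d (T a) b + ract d (T b) a.
Proof.
have [Hs Hp Hv Hw Ht] := derived_bilin HQ.
apply/lfunP => x; rewrite dual_opsE; last exact: comul_linear.
case: d; rewrite add_lfunE /lact /ract /comul /= ?opp_lfunE !adjE;
  by rewrite ?RmulE ?LmulE // pairingD pairingN ?pairing_act1 ?pairing_act2
    ?opprK.
Qed.

Lemma dual_ops_comul_bilin d : bilin (P d).
Proof. by apply: dual_ops_bilin => d'; apply: comul_linear. Qed.

(** Against [g], the left side is, up to sign, a derived product of [b] and [g] in the dual,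
    evaluated at [x]. After expansion by [dual_ops_T], the [lact] summands collapse to
    [g (Q d x (T b))] and the [ract] summands to [lact d x b (T g)], which [T_skew] turns into the
    last term. *)
Lemma mixed_A d x b : (mixed Q P d x b).1 = Q d x (T b) - T (lact d x b).
Proof.
have [Hs Hp Hv Hw Ht] := derived_bilin HQ.
have HP := dual_ops_comul_bilin.
have [HPs HPp HPv HPw HPt] := derived_bilin HP.
apply: dual_sep => g; rewrite linearB /= [X in _ - X]T_skew.
case: d; rewrite /lact /= ?[g (- _)]linearN ?opp_lfunE /= ?coadjE adjE ?LmulE //
  !RmulE // /qstar /qprec /qwedge ?add_lfunE !dual_ops_T !add_lfunE /lact /ract;
  rewrite /= ?opp_lfunE !adjE !LmulE // !RmulE // /qstar /qsucc /qprec /qvee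
  /qwedge !linearD /=; ring.
Qed.

Lemma mixed'_A d a x : (mixed' Q P d a x).1 = Q d (T a) x - T (ract d x a).
Proof.
have [Hs Hp Hv Hw Ht] := derived_bilin HQ.
have HP := dual_ops_comul_bilin.
have [HPs HPp HPv HPw HPt] := derived_bilin HP.
apply: dual_sep => g; rewrite linearB /= [X in _ - X]T_skew.
case: d; rewrite /ract /= ?[g (- _)]linearN ?opp_lfunE /= ?coadjE adjE ?RmulE //
  !LmulE // /qstar /qsucc /qvee ?add_lfunE !dual_ops_T !add_lfunE /lact /ract;
  rewrite /= ?opp_lfunE !adjE !LmulE // !RmulE // /qstar /qsucc /qprec /qvee
  /qwedge !linearD /=; ring.
Qed.

(** * The Q-equations as scalar identities about [T] *)

Definition pairing3 (u v w : dual A) (t : tensor A (tensor A A)) : F^o :=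
  tlift (fun a s => (u a * pairing v w s : F^o)) t.

Lemma pairing3_tens u v w a b c :
  pairing3 u v w (tens3 a b c) = u a * (v b * w c).
Proof.
rewrite /pairing3 /tens3 tlift_tens ?pairing_tens //.
split=> [y|x] k s t; first by rewrite linearP /= mulrDl -scalerAl.
by rewrite /pairing tlift_linear /= mulrDr -scalerAr.
Qed.

Lemma pairing3_linear u v w : linear (pairing3 u v w).
Proof. exact: tlift_linear. Qed.

Lemma pairing3_tlift2 u v w (f : A -> A -> A -> A -> tensor A (tensor A A)) :
  pairing3 u v w (tlift2 f r) =
  tlift2 (fun a b c d => pairing3 u v w (f a b c d)) r.
Proof.
rewrite /tlift2 (linear_tlift _ _ _ (pairing3_linear u v w)).
apply: tlift_ext => a b; exact: (linear_tlift _ _ _ (pairing3_linear u v w)).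
Qed.

Lemma dual_op_tlift (w : dual A) (op : A -> A -> A) (f g : A -> A -> A) :
  bilin op -> w (op (tlift f r) (tlift g r)) =
  tlift2 (fun a b c d => (w (op (f a b) (g c d)) : F^o)) r.
Proof.
have wl : linear w by move=> ? ? ?; apply: linearP.
move=> H; rewrite (bilin_tlift H) (linear_tlift w _ _ wl).
apply: tlift_ext => a b; exact: (linear_tlift w _ _ wl).
Qed.

Lemma pairing3_r12_r13 op u v w : bilin op ->
  pairing3 u v w (r12_r13 op r) = u (op (T v) (T w)).
Proof.
move=> H; rewrite pairing3_tlift2 dual_op_tlift //.
apply: tlift_ext => a b; apply: tlift_ext => c d.
rewrite pairing3_tens (bilinZl H) (bilinZr H) !linearZ /= /GRing.scale /=; ring.
Qed.

Lemma pairing3_r13_r23 op u v w : bilin op ->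
  pairing3 u v w (r13_r23 op r) = w (op (T u) (T v)).
Proof.
(* Both [u] and [v] contract first legs of [r], so [- T] occurs twice and the signs cancel. *)
move=> H; rewrite pairing3_tlift2 -[op _ _]opprK -(bilinNl H) -(bilinNr H).
rewrite !T_oppE dual_op_tlift //.
apply: tlift_ext => a b; apply: tlift_ext => c d.
rewrite pairing3_tens (bilinZl H) (bilinZr H) !linearZ /= /GRing.scale /=; ring.
Qed.

Lemma pairing3_r23_r12 op u v w : bilin op ->
  pairing3 u v w (r23_r12 op r) = - v (op (T w) (T u)).
Proof.
(* Only [u] contracts a first leg here, hence the single sign. *)
move=> H; rewrite pairing3_tlift2 -linearN /= -(bilinNr H).
rewrite T_oppE dual_op_tlift //.
apply: tlift_ext => a b; apply: tlift_ext => c d.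
rewrite pairing3_tens (bilinZl H) (bilinZr H) !linearZ /= /GRing.scale /=; ring.
Qed.

Lemma Q_equation_SW (u v w : dual A) :
  u (Q SW (T v) (T w)) = v (qwedge Q (T w) (T u)) + w (qsucc Q (T u) (T v)).
Proof.
have [Hs Hp Hv Hw Ht] := derived_bilin HQ.
have pl := pairing3_linear u v w; have := congr1 (pairing3 u v w) hr.1.
rewrite !(linear_funD pl) (linear_funN pl) (linear_fun0 pl) pairing3_r12_r13 //.
rewrite pairing3_r13_r23 // pairing3_r23_r12 // => /eqP.
by rewrite -opprD addrC subr_eq0 => /eqP.
Qed.

Lemma Q_equation_NE (u v w : dual A) :
  w (Q NE (T u) (T v)) = v (qvee Q (T w) (T u)) + u (qprec Q (T v) (T w)).
Proof.
have [Hs Hp Hv Hw Ht] := derived_bilin HQ.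
have pl := pairing3_linear u v w; have := congr1 (pairing3 u v w) hr.2.
rewrite !(linear_funD pl) (linear_funN pl) (linear_fun0 pl) pairing3_r12_r13 //.
rewrite pairing3_r13_r23 // pairing3_r23_r12 // => /eqP.
by rewrite -opprD addrC subr_eq0 => /eqP.
Qed.

(** Tested on [w] and moved across [T] by skew-symmetry, this becomes a scalar identity in [u], [v],
    [w]: one of the two Q-equations for NE and SW, and a consequence of both for NW and SE. *)
Lemma T_morph d u v :
  T (lact d (T u) v + ract d (T v) u) = Q d (T u) (T v).
Proof.
have [Hs Hp Hv Hw Ht] := derived_bilin HQ.
apply: dual_sep => w; rewrite T_skew add_lfunE.
(* Covers NW and, with the arguments rotated, SE; it is a combination of the
   SW and NE equations at rotated arguments. *)
have NW_eq (a b c : dual A) : c (Q NW (T a) (T b)) =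
    - b (Q SE (T c) (T a)) - a (qstar Q (T b) (T c)).
  have := Q_equation_SW c a b; have := Q_equation_NE c a b.
  rewrite /qstar /qvee /qprec /qwedge /qsucc !linearD /= => E1 E2.
  have -> : c (Q NW (T a) (T b)) = b (Q NE (T c) (T a)) -
      (a (Q SW (T b) (T c)) + a (Q SE (T b) (T c))) - c (Q SW (T a) (T b)).
    by rewrite E1; ring.
  by rewrite E2; ring.
case: d; rewrite /lact /ract /= ?opp_lfunE !adjE ?RmulE ?LmulE //.
- by rewrite NW_eq opprD.
- by rewrite Q_equation_NE opprD !opprK.
- by rewrite Q_equation_SW opprD !opprK addrC.
by rewrite NW_eq; ring.
Qed.

(** * Transport of the double and of the operator by [shear] *)

Lemma lact_bilin d : bilin (lact d).
Proof.
have H : bilin (mixed Q P d) := mixed_bilin HQ dual_ops_comul_bilin d.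
by split=> [b|x] c s t;
  [have := H.1 b c s t|have := H.2 x c s t] => /(congr1 snd).
Qed.

Lemma ract_bilin d : bilin (ract d).
Proof.
have H : bilin (mixed' Q P d) := mixed'_bilin HQ dual_ops_comul_bilin d.
by split=> [a|x] c s t;
  [have := H.2 a c s t|have := H.1 x c s t] => /(congr1 snd).
Qed.

(** The corrections [- T (lact d x b)] and [- T (ract d y a)] in the mixed products cancel what
    [shear] adds, while [T_morph] supplies the product of [T a] and [T b]. *)
Lemma shear_QD d u v :
  shear T (QD Q P d u v) =
  semidirect (Q d) (lact d) (ract d) (shear T u) (shear T v).
Proof.
case: u v => [x a] [y b]; rewrite /shear /semidirect /QD /=.
rewrite (surjective_pairing (mixed _ _ _ _ _)) mixed_A -/(lact d x b).
rewrite (surjective_pairing (mixed' _ _ _ _ _)) mixed'_A -/(ract d y a) /=.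
rewrite dual_ops_T !(bilinDl (HQ d)) !(bilinDr (HQ d)).
rewrite (bilinDl (lact_bilin d)) (bilinDl (ract_bilin d)) add0r addr0.
congr (_, _); last by rewrite addrACA.
rewrite (linear_funD T_linear) T_morph (linear_funD T_linear).
apply: dual_sep => g; rewrite !(linearD, linearN) /=; ring.
Qed.

Lemma shear_N_op l1 l2 l3 u :
  shear T (N_op r l1 l2 l3 u) =
  triangular_op T (l1 - l2 + l3) l2 l3 (shear T u).
Proof.
(* The coefficient [l1 - l2 + l3] comes from writing [x] as [(x + T a) - T a]. *)
congr (_, _); rewrite /= (linear_funZ T_linear); apply: dual_sep => g.
by rewrite !(linearD, linearZ) /= /GRing.scale /=; ring.
Qed.

Lemma N_op_linear l1 l2 l3 : linear (N_op r l1 l2 l3).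
Proof.
move=> c u v; congr (_, _) => /=; rewrite ?T_linear; apply: dual_sep => g;
  rewrite !(linearD, linearZ) /= /GRing.scale /=; ring.
Qed.

End InducedStructure.

Theorem proposition8p4 (F : fieldType) (A : vectType F) (Q : quadri_ops A)
    (r : tensor A A)
    (hQ : quadri_algebra Q) (hskew : skew_symmetric r) (hr : Q_equations Q r)
    (l1 l2 l3 : F) :
  nijenhuis (QD Q (dual_ops (comul Q r))) (N_op r l1 l2 l3).
Proof.
have HQ := quadri_bilin hQ.
split=> [|d u v]; first exact: N_op_linear.
(* By injectivity the identity may be checked after [shear], where it is the one for [triangular_op]
   on the semidirect product. *)
apply: (@shear_inj _ _ _ (T_ r)).
have shearDB x y z :
    shear (T_ r) (x + y - z) = shear (T_ r) x + shear (T_ r) y - shear (T_ r) z.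
  have sl := shear_linear (T_ r) T_linear.
  by rewrite (linear_funD sl) (linear_funN sl) (linear_funD sl).
rewrite shear_N_op [shear (T_ r) (_ - _)]shearDB shear_N_op.
rewrite !(shear_QD HQ hskew hr) !shear_N_op.
apply: semidirect_nijenhuis => //.
- exact: lact_bilin.
- exact: ract_bilin.
- exact: T_linear.
exact: T_morph.
Qed.
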